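(* Let $G$ be a graph of order $n$. Then: (1) $SEC(G)=1$ if and only if $G\cong K_1$. (2) $SEC(G)=2$ if and only if $G\cong K_2$ or $G\cong \overline{K_n}$ with $n\ge 2$.
   Context: Graphs are finite and simple with a non-empty vertex set; $n=|V(G)|$ is the order of $G$. $K_n$ is the complete graph on $n$ vertices and $\overline{K_n}$ its complement (the edgeless graph on $n$ vertices). A set $D\subseteq V(G)$ is a dominating set if every vertex of $V(G)\setminus D$ is adjacent to at least one vertex of $D$. A secure dominating set $S$ of $G$ is a dominating set such that each vertex $u\in V(G)\setminus S$ is adjacent to some vertex $v\in S$ for which $(S\setminus\{v\})\cup\{u\}$ is a dominating set. Two disjoint vertex sets $V_1,V_2\subseteq V(G)$ form a secure coalition if neither $V_1$ nor $V_2$ is a secure dominating set but $V_1\cup V_2$ is a secure dominating set. A secure coalition partition ($sec$-partition) of $G$ is a partition $\pi=\{V_1,\dots,V_k\}$ of $V(G)$ (into non-empty sets) such that every $V_i$ either is a secure dominating set consisting of a single vertex of degree $n-1$, or is not a secure dominating set but forms a secure coalition with another set $V_j\in\pi$. The secure coalition number $SEC(G)$ is the maximum cardinality of a secure coalition partition of $G$ (every graph has at least one such partition). *)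

(* Defs.v *)
From mathcomp Require Import all_boot.

Set Implicit Arguments.
Unset Strict Implicit.
Unset Printing Implicit Defensive.

(* The vertex type may be empty here; non-emptiness is a hypothesis where it
   matters. *)
Record sgraph := SGraph {
  vertex :> finType;
  adj : rel vertex;
  adj_sym : symmetric adj;
  adj_irrefl : irreflexive adj
}.

Definition graph_iso (G H : sgraph) : Prop :=
  exists f : G -> H,
    bijective f /\ (forall x y : G, adj (f x) (f y) = adj x y).

Definition complete_rel (n : nat) : rel 'I_n := [rel i j | i != j].

Lemma complete_sym n : symmetric (@complete_rel n).
Proof. by move=> i j; rewrite /complete_rel /= eq_sym. Qed.

Lemma complete_irrefl n : irreflexive (@complete_rel n).
Proof. by move=> i; rewrite /complete_rel /= eqxx. Qed.

Definition complete_graph (n : nat) : sgraph :=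
  SGraph (@complete_sym n) (@complete_irrefl n).

Definition compl_rel (G : sgraph) : rel G :=
  [rel x y | (x != y) && ~~ adj x y].

Lemma compl_sym (G : sgraph) : symmetric (@compl_rel G).
Proof. by move=> x y; rewrite /compl_rel /= eq_sym adj_sym. Qed.

Lemma compl_irrefl (G : sgraph) : irreflexive (@compl_rel G).
Proof. by move=> x; rewrite /compl_rel /= eqxx. Qed.

Definition compl_graph (G : sgraph) : sgraph :=
  SGraph (@compl_sym G) (@compl_irrefl G).

Definition degree (G : sgraph) (v : G) : nat := #|[set w | adj v w]|.

Definition dominating (G : sgraph) (S : {set G}) : bool :=
  [forall u, (u \notin S) ==> [exists v in S, adj u v]].

Definition secure_dominating (G : sgraph) (S : {set G}) : bool :=
  dominating S &&
  [forall u, (u \notin S) ==>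
     [exists v in S, adj u v && dominating (u |: (S :\ v))]].

Definition secure_coalition (G : sgraph) (A B : {set G}) : bool :=
  [&& [disjoint A & B], ~~ secure_dominating A, ~~ secure_dominating B
    & secure_dominating (A :|: B)].

(* In the second alternative B is automatically different from A, since a
   secure coalition is disjoint and the blocks of a partition are non-empty. *)
Definition sec_partition (G : sgraph) (P : {set {set G}}) : bool :=
  partition P [set: G] &&
  [forall A in P,
     (secure_dominating A
        && [exists v, (A == [set v]) && (degree v == #|G|.-1)])
     || (~~ secure_dominating A && [exists B in P, secure_coalition A B])].

(* The value would be 0 if G had no secure coalition partition. *)
Definition SEC (G : sgraph) : nat :=
  \max_(P : {set {set G}} | sec_partition P) #|P|.

(* Main.v *)
Require Import Defs.
From mathcomp Require Import all_boot.
From Corelib Require Import Setoid.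

(** Everything follows from computing [SEC G] in three cases.

    If [G] is complete, every singleton is a secure dominating set formed by a
    vertex of full degree, so the partition into singletons is admissible and
    [SEC G] is the order of [G] ([SEC_complete]).

    If [G] is not complete, then no singleton is secure dominating
    ([secure_dominating1]), so that every block needs a partner.  Partitions of
    one kind suffice to bound [SEC G] from below: a set [A] that is not secure
    dominating but becomes so as soon as any single outside vertex is added,
    together with the singletons of its complement, each of which is a partner
    of [A] ([star_sec_partition]).

    If [G] is edgeless with at least two vertices, the whole vertex set is the
    only dominating set.  Two partners therefore cover all vertices and there
    are at most two blocks; the complement of one vertex, taken as [A], shows
    that two are reached ([SEC_edgeless]).

    If [G] has an edge and is not complete, take for [A] a maximal set that is
    not secure dominating among those containing all isolated vertices.  The
    complement of a non-isolated vertex is always secure dominating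
    ([secure_dominatingC1]), so [A] misses at least two vertices, and
    [SEC G >= 3] ([SEC_ge3]).

    Hence [SEC G] is 1 or 2 only for complete graphs of that order and for
    edgeless graphs. *)

Set Implicit Arguments.
Unset Strict Implicit.
Unset Printing Implicit Defensive.

Section SecurePartitions.

Variable G : sgraph.
Implicit Types (A B S : {set G}) (P : {set {set G}}) (x y v : G).

(** * Complete and edgeless graphs *)

Definition is_complete := [forall x : G, forall y : G, (x != y) ==> adj x y].
Definition is_edgeless := [forall x : G, forall y : G, ~~ adj x y].

Lemma completeP : reflect (forall x y, x != y -> adj x y) is_complete.
Proof.
apply: (iffP forallP) => H x; first by move=> y; apply: implyP; apply/forallP: y.
by apply/forallP=> y; apply/implyP/H.
Qed.

Lemma edgelessP : reflect (forall x y, ~~ adj x y) is_edgeless.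
Proof. by apply: (iffP forallP) => H x; apply/forallP. Qed.

Lemma card_gt1_incomplete : ~~ is_complete -> 1 < #|G|.
Proof.
by case/forallPn=> x /forallPn[y]; rewrite negb_imply => /andP[xy _];
  apply/card_gt1P; exists x, y.
Qed.

(** * Secure dominating sets *)

Lemma secure_dominatingT : secure_dominating [set: G].
Proof.
by apply/andP; split; apply/forallP=> u; rewrite inE.
Qed.

(** Swapping the vertex of a singleton for another one must again dominate, so
    a secure dominating singleton makes every vertex universal. *)
Lemma secure_dominating1 v : secure_dominating [set v] -> is_complete.
Proof.
case/andP=> dom_v /forallP sec_v.
have dom1 (u : G) : dominating [set u].
  have [->//|uv] := eqVneq u v.
  have := implyP (sec_v u); rewrite inE => /(_ uv) /exists_inP[w /set1P->].
  by rewrite setDv setU0 => /andP[].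
apply/completeP=> x y xy.
have := implyP (forallP (dom1 y) x); rewrite inE => /(_ xy).
by case/exists_inP=> w /set1P->.
Qed.

(** The missing vertex [b] is defended by its neighbour [v]: after the swap [v]
    is the missing vertex, and it is dominated by [b]. *)
Lemma secure_dominatingC1 b v : adj b v -> secure_dominating [set~ b].
Proof.
move=> bv; have vb : v != b by apply: contraTneq bv => ->; rewrite adj_irrefl.
apply/andP; split; apply/forallP=> u; apply/implyP; rewrite !inE negbK => /eqP->;
  apply/exists_inP; exists v; rewrite ?inE ?bv //=.
apply/forallP=> w; apply/implyP; rewrite !inE.
case: (eqVneq w b) => //= wb; rewrite andbT negbK => /eqP->.
by apply/exists_inP; exists b; rewrite ?inE ?eqxx // adj_sym.
Qed.

Lemma secure_dominating1_complete v : is_complete -> secure_dominating [set v].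
Proof.
move=> /completeP adjG.
have dom1 (u : G) : dominating [set u].
  apply/forallP=> w; apply/implyP; rewrite inE => wu.
  by apply/exists_inP; exists u; rewrite ?inE ?adjG.
rewrite /secure_dominating dom1; apply/forallP=> w; apply/implyP; rewrite inE => wv.
by apply/exists_inP; exists v; rewrite ?inE // adjG //= setDv setU0.
Qed.

Lemma dominating_edgeless S : is_edgeless -> dominating S -> S = setT.
Proof.
move=> /edgelessP noadj /forallP domS; apply/eqP; rewrite -subTset.
apply/subsetP=> u _; apply: contraT => uS.
by have /exists_inP[v _] := implyP (domS u) uS; rewrite (negPf (noadj u v)).
Qed.

(** * Admissible partitions *)

Definition singletons A : {set {set G}} := [set [set x] | x in A].

Lemma singletons_partition A : partition (singletons A) A.
Proof.
have [||part _] := @indexed_partition _ _ [in A] (@set1 G).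
- by move=> x y _ _ yx; rewrite disjoints1 inE eq_sym.
- by move=> x _; apply/set0Pn; exists x; rewrite inE.
rewrite -[X in partition _ X](_ : cover (singletons A) = A) //.
apply/setP=> x; apply/bigcupP/idP => [[_ /imsetP[y yA ->] /set1P->]//|xA].
by exists [set x]; rewrite ?inE ?imset_f.
Qed.

Lemma card_singletons A : #|singletons A| = #|A|.
Proof. by rewrite card_imset //; apply: set1_inj. Qed.

Lemma SEC_ge P : sec_partition P -> #|P| <= SEC G.
Proof. by move=> secP; apply: (leq_bigmax_cond (F := fun P => #|P|)). Qed.

Lemma SEC_le_order : SEC G <= #|G|.
Proof.
apply/bigmax_leqP=> P /andP[partP _].
rewrite -cardsT (card_partition partP) -sum1_card; apply: leq_sum => A AP.
by rewrite card_gt0 (partition_neq0 partP AP).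
Qed.

(** * The secure coalition number *)

(** Each singleton is itself secure dominating and of full degree, so no
    partner is called for. *)
Lemma SEC_complete : is_complete -> SEC G = #|G|.
Proof.
move=> complG; apply/eqP; rewrite eqn_leq SEC_le_order /=.
rewrite -cardsT -card_singletons; apply: SEC_ge.
rewrite /sec_partition singletons_partition; apply/forall_inP=> _ /imsetP[v _ ->].
rewrite secure_dominating1_complete //=; apply/orP; left.
apply/existsP; exists v; rewrite eqxx /=.
rewrite (cardD1 v) inE /= /degree; apply/eqP/eq_card=> w; rewrite !inE andbT.
have [->|wv] := eqVneq w v; first by rewrite adj_irrefl.
by apply: (completeP complG); rewrite eq_sym.
Qed.

(** The blocks are [A] and the singletons outside [A]: each singleton forms a
    secure coalition with [A], so this is an admissible partition with
    [#|~: A| + 1] blocks. *)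
Lemma star_sec_partition A :
    ~~ is_complete -> A != set0 -> ~~ secure_dominating A ->
    (forall x, x \notin A -> secure_dominating (x |: A)) ->
  #|~: A| < SEC G.
Proof.
move=> incompl A0 nsecA secAx.
have nsec1 x : ~~ secure_dominating [set x].
  by apply: contra incompl; apply: secure_dominating1.
have partC := singletons_partition (~: A).
have AnC : A \notin singletons (~: A).
  apply/imsetP=> -[x]; rewrite inE => xA defA.
  by rewrite {1}defA set11 in xA.
have <- : #|A |: singletons (~: A)| = #|~: A|.+1.
  by rewrite cardsU1 AnC card_singletons.
apply: SEC_ge; apply/andP; split.
  rewrite -(setUCr A); apply: partitionU1 => //.
  by rewrite -setI_eq0 setICr.
apply/forall_inP=> B /setU1P[->|/imsetP[x]].
  have [x xA] : exists x, x \notin A.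
    apply/existsP; rewrite -negb_forall; apply: contra nsecA => /forallP AT.
    by rewrite (_ : A = setT) ?secure_dominatingT //; apply/setP=> x; rewrite AT inE.
  apply/orP; right; rewrite nsecA; apply/exists_inP; exists [set x].
    by apply/setU1P; right; apply: imset_f; rewrite inE.
  by rewrite /secure_coalition disjoint_sym disjoints1 xA nsecA nsec1 setUC secAx.
rewrite inE => xA ->; apply/orP; right; rewrite nsec1; apply/exists_inP; exists A.
  exact: setU11.
by rewrite /secure_coalition disjoints1 xA nsecA nsec1 secAx.
Qed.

(** Without edges a secure dominating set is everything, so two partners
    already cover the graph and leave no room for a third block. *)
Lemma SEC_edgeless : is_edgeless -> 1 < #|G| -> SEC G = 2.
Proof.
move=> edgelessG gt1.
have secT S : secure_dominating S -> S = setT.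
  by case/andP=> domS _; apply: dominating_edgeless.
apply/eqP; rewrite eqn_leq; apply/andP; split.
  apply/bigmax_leqP=> P /andP[partP /forall_inP secP].
  have [->|[A AP]] := set_0Vmem P; first by rewrite cards0.
  case/orP: (secP A AP) => [/andP[/secT AT /existsP[v /andP[/eqP Av _]]]|].
    by move: gt1; rewrite -cardsT -AT Av cards1.
  case/andP=> _ /exists_inP[B BP /and4P[_ _ _ /secT ABT]].
  suff sub : P \subset [set A; B].
    by rewrite (leq_trans (subset_leq_card sub)) // cards2; case: (_ != _).
  apply/subsetP=> C CP; have /set0Pn[x xC] := partition_neq0 partP CP.
  have tiP := partition_trivIset partP.
  have : x \in A :|: B by rewrite ABT inE.
  rewrite -(def_pblock tiP CP xC).
  by case/setUP=> [xA|xB]; [rewrite (def_pblock tiP AP xA) set21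
                     | rewrite (def_pblock tiP BP xB) set22].
have [x [y [_ _ xy]]] := card_gt1P gt1.
have -> : 2 = #|~: [set~ x]|.+1 by rewrite setCK cards1.
apply: star_sec_partition.
- apply/completeP=> /(_ x y xy); exact/negP/(edgelessP edgelessG).
- by apply/set0Pn; exists y; rewrite !inE eq_sym.
- by apply/negP=> /secT/setP/(_ x); rewrite !inE eqxx.
- by move=> z; rewrite !inE negbK => /eqP->; rewrite setUCr secure_dominatingT.
Qed.

(** A maximal set [A] that is not secure dominating would do for
    [star_sec_partition], but it might miss a single isolated vertex only, which
    gives two blocks.  Forcing the isolated vertices into [A] excludes this: the
    outside vertices then have neighbours, and removing just one of those from
    the graph leaves a secure dominating set. *)
Lemma SEC_ge3 : ~~ is_complete -> ~~ is_edgeless -> 2 < SEC G.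
Proof.
move=> incompl /forallPn[x0 /forallPn[y0]]; rewrite negbK => adj0.
pose I := [set x : G | [forall y, ~~ adj x y]].
(* A non-isolated vertex, which exists, has no neighbour in I. *)
have nsecI : ~~ secure_dominating I.
  apply/negP=> /andP[/forallP domI _].
  have x0I : x0 \notin I by rewrite inE; apply/forallPn; exists y0; rewrite negbK.
  have /exists_inP[v] := implyP (domI x0) x0I.
  by rewrite inE adj_sym => /forallP/(_ x0)/negPf->.
have [A maxA subIA] :=
  maxset_exists (P := [pred S | ~~ secure_dominating S]) nsecI.
have /= nsecA := maxsetp maxA.
have secAx x : x \notin A -> secure_dominating (x |: A).
  apply: contraR => nsec.
  by rewrite -(maxsetsup maxA nsec (subsetUr _ _)) setU11.
have nsec1 x : ~~ secure_dominating [set x].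
  by apply: contra incompl; apply: secure_dominating1.
have A0 : A != set0.
  apply: contraNneq (nsec1 x0) => A0; have := secAx x0.
  by rewrite A0 setU0 inE; apply.
apply: leq_ltn_trans (star_sec_partition incompl A0 nsecA secAx).
rewrite leqNgt; apply: contra nsecA; rewrite ltnS leq_eqVlt ltnS leqn0.
case/orP=> [/cards1P[b defb]|].
  have : b \notin I.
    by apply/negP=> /(subsetP subIA); apply/negP; rewrite -in_setC defb set11.
  rewrite inE => /forallPn[v]; rewrite negbK => /secure_dominatingC1.
  by rewrite -defb setCK.
by rewrite cards_eq0 => /eqP AC0; rewrite -[A]setCK AC0 setC0 secure_dominatingT.
Qed.

(** * Isomorphism types *)

Lemma bij_ord n : #|G| = n -> exists f : G -> 'I_n, bijective f.
Proof. by move=> <-; exists enum_rank; apply: enum_rank_bij. Qed.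

Lemma iso_complete n : graph_iso G (complete_graph n) <-> #|G| = n /\ is_complete.
Proof.
split=> [[f [bij_f morph_f]]|[/bij_ord[f bij_f] /completeP complG]].
  split; first by rewrite (bij_eq_card bij_f) card_ord.
  by apply/completeP=> x y xy; rewrite -morph_f /= /complete_rel /= (inj_eq (bij_inj bij_f)).
exists f; split=> // x y; rewrite /= /complete_rel /= (inj_eq (bij_inj bij_f)).
have [->|xy] := eqVneq x y; first by rewrite adj_irrefl.
by rewrite complG.
Qed.

Lemma iso_edgeless n :
  graph_iso G (compl_graph (complete_graph n)) <-> #|G| = n /\ is_edgeless.
Proof.
have noadj (i j : compl_graph (complete_graph n)) : adj i j = false.
  by rewrite /= /compl_rel /= /complete_rel /= andbN.
split=> [[f [bij_f morph_f]]|[/bij_ord[f bij_f] /edgelessP edgelessG]].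
  split; first by rewrite (bij_eq_card bij_f) card_ord.
  by apply/edgelessP=> x y; rewrite -morph_f noadj.
by exists f; split=> // x y; rewrite noadj (negPf (edgelessG x y)).
Qed.

End SecurePartitions.

Theorem theorem2p6 (G : sgraph) (n : nat) (n_gt0 : 0 < n) (order_G : #|G| = n) :
  (SEC G = 1 <-> graph_iso G (complete_graph 1)) /\
  (SEC G = 2 <->
     graph_iso G (complete_graph 2) \/
     (2 <= n /\ graph_iso G (compl_graph (complete_graph n)))).
Proof.
rewrite !iso_complete iso_edgeless.
have SEC_edgeless_n : 1 < n -> is_edgeless G -> SEC G = 2.
  by rewrite -order_G => gt1 edgelessG; apply: SEC_edgeless.
have [complG|incompl] := boolP (is_complete G).
  rewrite (SEC_complete complG) in SEC_edgeless_n *.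
  split; split=> [->|]; [by []|by case|by left|].
  by case=> [[]//|[n_gt1 [_ edgelessG]]]; apply: SEC_edgeless_n.
have gt1 := card_gt1_incomplete incompl; rewrite order_G in gt1.
have [edgelessG|edgeG] := boolP (is_edgeless G).
  rewrite SEC_edgeless_n //; split; split=> //; first by case.
  by right.
have gt2 := SEC_ge3 incompl edgeG.
split; split=> [E|].
- by rewrite E in gt2.
- by case=> _ complG; case/negP: incompl.
- by rewrite E in gt2.
- by case=> [[_ complG]|[_ [_ edgelessG]]]; [case/negP: incompl | case/negP: edgeG].
Qed.
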